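(* For all positive integers $N$, all $N$-point sets $\mathcal{P} \subset [0,1)^2$ and all systems of real weights $a=(a_z)_{z\in\mathcal{P}}$, the weighted discrepancy function $D_{\mathcal{P},a}$ satisfies $$ \| D_{\mathcal{P},a} \mid L_2 \| \ge c \sqrt{\log N} \qquad\text{with}\qquad c = \frac{7}{216\,\sqrt{\log 2}} = 0.038925\ldots .$$
   Context: $\log$ denotes the natural logarithm. For a finite set $\mathcal{P}\subset[0,1)^2$ with $N$ (distinct) points and a system $a=(a_z)_{z\in\mathcal{P}}$ of real numbers, the weighted discrepancy function is defined for $x=(x_1,x_2)\in[0,1)^2$ by $$ D_{\mathcal{P},a}(x) = \sum_{z\in\mathcal{P}} a_z\,\mathbf{1}_{C_z}(x) - N\,|B_x|, $$ where $|B_x| = x_1x_2$ is the area of the rectangle $B_x=[0,x_1)\times[0,x_2)$ and $\mathbf{1}_{C_z}$ is the characteristic function of $C_z=(z_1,1)\times(z_2,1)$ for $z=(z_1,z_2)$. The norm is $\|D_{\mathcal{P},a} \mid L_2\| = \left(\int_{[0,1)^2} D_{\mathcal{P},a}(x)^2\,dx\right)^{1/2}$. *)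

(* Defs.v *)
From HB Require Import structures.
From mathcomp Require Import all_boot all_order all_algebra finmap.
From mathcomp Require Import all_classical all_reals all_analysis.

Set Implicit Arguments.
Unset Strict Implicit.
Unset Printing Implicit Defensive.

Import Order.TTheory GRing.Theory Num.Theory.
Import numFieldNormedType.Exports.

Local Open Scope classical_set_scope.
Local Open Scope ring_scope.

Section WeightedDiscrepancy.
Variable R : realType.
Implicit Types (z x : R * R) (P : {fset R * R}).

Definition unit_square : set (R * R) := `[0, 1[ `*` `[0, 1[.

Definition corner z : set (R * R) := `]z.1, 1[ `*` `]z.2, 1[.

(* The number of points is #|` P|, the cardinality of P; the area of
   [0, x.1) x [0, x.2) is x.1 * x.2 for x in the unit square, the only region
   where values of the function are used. The weights are indexed by the
   elements of P. *)
Definition weighted_discrepancy P (a : P -> R) x : R :=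
  \sum_(z : P) a z * \1_(corner (val z)) x - #|` P|%:R * (x.1 * x.2).

Definition L2norm_square (f : R * R -> R) : R :=
  Num.sqrt (\int[(@lebesgue_measure R \x @lebesgue_measure R)%E]_(x in
    unit_square) (f x ^+ 2)).

End WeightedDiscrepancy.

(* Main.v *)
(** The lower bound is Bessel's inequality in L2([0,1)^2) for tensor products of
    Haar functions. If the dyadic box I x J (sides l and l') contains no point
    of P, then every 1_{C_z} is orthogonal to h_I (x) h_J, so whatever the
    weights are, the coefficient of D is - N <x1 x2, h_I (x) h_J> =
    - N l^2 l'^2 / 16; at most N boxes of a given shape contain a point. Plain
    dyadic boxes are too rigid to give the constant 7/216 for every N: here the
    sides in the first coordinate are w / 2^j, w = (7/9) 2^M / N in ]1/2, 1], so
    that the areas are exactly (7/9) 2^(-k) / N, and t = 7/9 maximises the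
    asymptotic gain t^2 (4/3 - 8 t / 7) per shape. Only the intervals of length
    w / 2^j that fit into [0,1) are used; what is lost near 1 is compensated by
    the functions h_I (x) 1. *)
Require Import Defs.
From mathcomp Require Import all_boot all_order all_algebra finmap.
From mathcomp Require Import all_classical all_reals all_analysis.
From mathcomp Require Import measurable_realfun.
From mathcomp Require Import ring lra zify.
Import Order.TTheory GRing.Theory Num.Theory.
Import numFieldNormedType.Exports.
Local Open Scope classical_set_scope.
Local Open Scope ring_scope.

(** * Bessel's inequality for bounded measurable functions *)
Section BoundedMeasurable.
Context d (T : measurableType d) (R : realType).
Variables (mu : {measure set T -> \bar R}) (D : set T).
Hypotheses (mD : measurable D) (finD : (mu D < +oo)%E).

(** On a set of finite measure these functions form an algebra of integrable functions, so
    membership settles the integrability conditions below. *)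
Definition bounded_measurable (f : T -> R) :=
  measurable_fun D f /\ exists M, forall x, D x -> `|f x| <= M.

Lemma bounded_measurable_cst c : bounded_measurable (fun=> c).
Proof. by split; [exact: measurable_cst | exists `|c|]. Qed.

Lemma bounded_measurableD f g : bounded_measurable f -> bounded_measurable g ->
  bounded_measurable (fun x => f x + g x).
Proof.
move=> [mf [M fM]] [mg [K gK]]; split; first exact: measurable_funD.
exists (M + K) => x Dx; apply: le_trans (ler_normD _ _) _.
by rewrite lerD ?fM ?gK.
Qed.

Lemma bounded_measurableM f g : bounded_measurable f -> bounded_measurable g ->
  bounded_measurable (fun x => f x * g x).
Proof.
move=> [mf [M fM]] [mg [K gK]]; split; first exact: measurable_funM.
by exists (M * K) => x Dx; rewrite normrM ler_pM ?fM ?gK.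
Qed.

Lemma bounded_measurableZ c f : bounded_measurable f ->
  bounded_measurable (fun x => c * f x).
Proof. exact/bounded_measurableM/bounded_measurable_cst. Qed.

Lemma bounded_measurableB f g : bounded_measurable f -> bounded_measurable g ->
  bounded_measurable (fun x => f x - g x).
Proof.
move=> bf bg.
have := bounded_measurableD _ _ bf (bounded_measurableZ (-1) _ bg).
by under [X in bounded_measurable X -> _]eq_fun do rewrite mulN1r.
Qed.

Lemma bounded_measurable_sum (I : Type) (s : seq I) (F : I -> T -> R) :
  (forall i, bounded_measurable (F i)) ->
  bounded_measurable (fun x => \sum_(i <- s) F i x).
Proof.
move=> bF; elim: s => [|i s ih].
  by under eq_fun do rewrite big_nil; exact: bounded_measurable_cst.
by under eq_fun do rewrite big_cons; exact: bounded_measurableD.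
Qed.

Lemma bounded_measurable_indic A : measurable A ->
  bounded_measurable (\1_A : T -> R).
Proof.
move=> mA; split; first exact: measurable_indic.
by exists 1 => x _; rewrite indicE; case: (_ \in _); rewrite ?normr1 ?normr0.
Qed.

Lemma bounded_measurable_integrable f :
  bounded_measurable f -> mu.-integrable D (EFin \o f).
Proof.
move=> [mf [M fM]]; apply: measurable_bounded_integrable => //.
exists M; split; first exact: num_real.
by move=> r Mr x Dx; exact: le_trans (fM _ Dx) (ltW Mr).
Qed.

Lemma Rintegral_bmD f g : bounded_measurable f -> bounded_measurable g ->
  \int[mu]_(x in D) (f x + g x) = \int[mu]_(x in D) f x + \int[mu]_(x in D) g x.
Proof.
by move=> bf bg; rewrite RintegralD//; exact: bounded_measurable_integrable.
Qed.

Lemma Rintegral_bmB f g : bounded_measurable f -> bounded_measurable g ->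
  \int[mu]_(x in D) (f x - g x) = \int[mu]_(x in D) f x - \int[mu]_(x in D) g x.
Proof.
by move=> bf bg; rewrite RintegralB//; exact: bounded_measurable_integrable.
Qed.

Lemma Rintegral_bmZ c f : bounded_measurable f ->
  \int[mu]_(x in D) (c * f x) = c * \int[mu]_(x in D) f x.
Proof.
by move=> bf; rewrite RintegralZl//; exact: bounded_measurable_integrable.
Qed.

Lemma Rintegral_bm_sum (I : Type) (s : seq I) (F : I -> T -> R) :
  (forall i, bounded_measurable (F i)) ->
  \int[mu]_(x in D) (\sum_(i <- s) F i x) =
  \sum_(i <- s) \int[mu]_(x in D) F i x.
Proof.
move=> bF; elim: s => [|i s ih].
  rewrite big_nil; under eq_Rintegral do rewrite big_nil.
  by rewrite Rintegral_cst// mul0r.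
under eq_Rintegral do rewrite big_cons.
by rewrite Rintegral_bmD ?ih ?big_cons//; exact: bounded_measurable_sum.
Qed.

(** With [F] the orthogonal projection of [f] on the span of the [phi i], the integrals of [f * F]
    and [F * F] both equal the left-hand sum, and the claim is that the integral of [(f - F) ^+ 2]
    is nonnegative. *)
Lemma bessel_inequality (I : eqType) (s : seq I) (phi : I -> T -> R) f :
    uniq s -> bounded_measurable f -> (forall i, bounded_measurable (phi i)) ->
    {in s &, forall i j, i != j -> \int[mu]_(x in D) (phi i x * phi j x) = 0} ->
    {in s, forall i, 0 < \int[mu]_(x in D) (phi i x ^+ 2)} ->
  \sum_(i <- s) (\int[mu]_(x in D) (f x * phi i x)) ^+ 2 /
                \int[mu]_(x in D) (phi i x ^+ 2)
    <= \int[mu]_(x in D) (f x ^+ 2).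
Proof.
move=> us bf bphi orth pos.
pose p i := \int[mu]_(x in D) (f x * phi i x).
pose n i := \int[mu]_(x in D) (phi i x ^+ 2).
pose c i := p i / n i.
pose F x := \sum_(i <- s) c i * phi i x.
have bcphi i : bounded_measurable (fun x => c i * phi i x).
  exact: bounded_measurableZ.
have bF : bounded_measurable F by exact: bounded_measurable_sum.
have fF : \int[mu]_(x in D) (f x * F x) = \sum_(i <- s) p i ^+ 2 / n i.
  under eq_Rintegral do rewrite mulr_sumr.
  rewrite Rintegral_bm_sum; last by move=> i; exact: bounded_measurableM.
  apply: eq_bigr => i _.
  under eq_Rintegral do rewrite mulrCA.
  rewrite Rintegral_bmZ; last exact: bounded_measurableM.
  by rewrite -/(p i) expr2 mulrAC.
have phiF i : i \in s -> \int[mu]_(x in D) (phi i x * F x) = p i.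
  move=> si; under eq_Rintegral do rewrite mulr_sumr.
  rewrite Rintegral_bm_sum; last by move=> j; exact: bounded_measurableM.
  rewrite (bigD1_seq i)//= big_seq_cond big1 ?addr0.
    under eq_Rintegral do rewrite mulrCA -expr2.
    rewrite Rintegral_bmZ; last first.
      by under eq_fun do rewrite expr2; exact: bounded_measurableM.
    by rewrite -/(n i) /c divfK// gt_eqF// pos.
  move=> j /andP[sj ji]; under eq_Rintegral do rewrite mulrCA.
  rewrite Rintegral_bmZ; last exact: bounded_measurableM.
  by rewrite orth ?mulr0// eq_sym.
have FF : \int[mu]_(x in D) (F x * F x) = \sum_(i <- s) p i ^+ 2 / n i.
  under eq_Rintegral do rewrite {1}/F mulr_suml.
  rewrite Rintegral_bm_sum; last by move=> i; exact: bounded_measurableM.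
  apply: eq_big_seq => i si.
  under eq_Rintegral do rewrite -mulrA.
  rewrite Rintegral_bmZ; last exact: bounded_measurableM.
  by rewrite phiF// expr2 mulrAC.
have : 0 <= \int[mu]_(x in D) ((f x - F x) ^+ 2).
  by apply: Rintegral_ge0 => x _; exact: sqr_ge0.
under eq_Rintegral => x _.
  have -> : (f x - F x) ^+ 2 = f x ^+ 2 - (2 * (f x * F x) - F x * F x) by ring.
  over.
have bff : bounded_measurable (fun x => f x ^+ 2).
  by under eq_fun do rewrite expr2; exact: bounded_measurableM.
have bfF : bounded_measurable (fun x => f x * F x) by exact: bounded_measurableM.
have bFF : bounded_measurable (fun x => F x * F x) by exact: bounded_measurableM.
have b2fF := bounded_measurableZ 2 _ bfF.
rewrite (Rintegral_bmB _ _ bff (bounded_measurableB _ _ b2fF bFF)).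
by rewrite Rintegral_bmB// Rintegral_bmZ// fF FF; lra.
Qed.

End BoundedMeasurable.

(** * Product measures and integrals of tensor products *)

Section Tensor.
Context d1 d2 (T1 : measurableType d1) (T2 : measurableType d2) (R : realType).
Variables (m1 : {sigma_finite_measure set T1 -> \bar R})
          (m2 : {sigma_finite_measure set T2 -> \bar R}).
Variables (D1 : set T1) (D2 : set T2).
Hypotheses (mD1 : measurable D1) (mD2 : measurable D2).
Hypotheses (fin1 : (m1 D1 < +oo)%E) (fin2 : (m2 D2 < +oo)%E).

Lemma bounded_measurable_fst (f : T1 -> R) : bounded_measurable _ _ _ D1 f ->
  bounded_measurable _ _ _ (D1 `*` D2) (fun z => f z.1).
Proof.
move=> [mf [M fM]]; split; last by exists M => -[x y] [/= /fM].
apply: (measurable_comp mD1 _ mf) => //; last exact: measurable_funTS.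
by move=> _ [[x y] [/= Dx _] <-].
Qed.

Lemma bounded_measurable_snd (f : T2 -> R) : bounded_measurable _ _ _ D2 f ->
  bounded_measurable _ _ _ (D1 `*` D2) (fun z => f z.2).
Proof.
move=> [mf [M fM]]; split; last by exists M => -[x y] [/= _ /fM].
apply: (measurable_comp mD2 _ mf) => //; last exact: measurable_funTS.
by move=> _ [[x y] [/= _ Dy] <-].
Qed.

Lemma product_measure_lty : ((m1 \x m2) (D1 `*` D2) < +oo)%E.
Proof.
by rewrite product_measure1E// lte_mul_pinfty// ge0_fin_numE.
Qed.

Lemma Rintegral_tensor (f : T1 -> R) (g : T2 -> R) :
    bounded_measurable _ _ _ D1 f -> bounded_measurable _ _ _ D2 g ->
  \int[(m1 \x m2)%E]_(z in D1 `*` D2) (f z.1 * g z.2) =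
  \int[m1]_(x in D1) f x * \int[m2]_(y in D2) g y.
Proof.
move=> bf bg.
have mD : measurable (D1 `*` D2) by exact: measurableX.
have iF := bounded_measurable_integrable _ _ _ (m1 \x m2)%E _ mD
  product_measure_lty _ (bounded_measurableM _ _ _ _ _ _
    (bounded_measurable_fst _ bf) (bounded_measurable_snd _ bg)).
have ig := bounded_measurable_integrable _ _ _ m2 _ mD2 fin2 _ bg.
have if1 := bounded_measurable_integrable _ _ _ m1 _ mD1 fin1 _ bf.
(* Extension by zero turns the integrand into a tensor product on the whole space, where Fubini
   applies; the inner integral is then a constant times the first factor. *)
have FE : (EFin \o (fun z => f z.1 * g z.2)) \_ (D1 `*` D2) =
          (fun z => ((f \_ D1) z.1 * (g \_ D2) z.2)%:E).
  apply/funext => -[x y]; rewrite !patchE/= in_setX/=.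
  by case: (x \in D1); case: (y \in D2); rewrite ?mulr0 ?mul0r.
have /(integrable_mkcond _ mD) iF' := iF; rewrite FE in iF'.
have gE : (EFin \o g) \_ D2 = EFin \o (g \_ D2) by rewrite restrict_EFin.
have fE : (EFin \o f) \_ D1 = EFin \o (f \_ D1) by rewrite restrict_EFin.
have ig' : m2.-integrable setT (EFin \o (g \_ D2)).
  by rewrite -gE; exact/(integrable_mkcond _ mD2).
have if' : m1.-integrable setT (EFin \o (f \_ D1)).
  by rewrite -fE; exact/(integrable_mkcond _ mD1).
rewrite /Rintegral integral_mkcond [X in integral _ _ X]FE.
rewrite -(integral12_prod_meas1 iF').
have -> : fubini_F m2 (fun z => ((f \_ D1) z.1 * (g \_ D2) z.2)%:E) =
   (fun x => \int[m2]_y ((g \_ D2) y)%:E * ((f \_ D1) x)%:E)%E.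
  apply/funext => x; rewrite /fubini_F/=.
  under eq_integral do rewrite EFinM.
  by rewrite integralZl//= muleC.
have fg := integrable_fin_num measurableT ig'.
rewrite -(fineK fg) integralZl//=.
rewrite fineM//; last exact: (integrable_fin_num measurableT if').
by rewrite mulrC (integral_mkcond D1) (integral_mkcond D2) gE fE.
Qed.

End Tensor.

(** * Integration over the unit interval *)
Section UnitInterval.
Variable R : realType.
Notation mu := (@lebesgue_measure R).
Notation I01 := (`[0, 1[%classic : set R).

Lemma mI01 : measurable I01. Proof. exact: measurable_itv. Qed.

Lemma lebesgue_measure_itv_lty (a b : R) : (mu `[a, b[%classic < +oo)%E.
Proof. by rewrite lebesgue_measure_itv/=; case: ifP; rewrite ?ltry. Qed.

Lemma fin_I01 : (mu I01 < +oo)%E.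
Proof. exact: lebesgue_measure_itv_lty. Qed.

Definition bm01 := bounded_measurable _ _ R I01.

Lemma Rintegral01B (f g : R -> R) : bm01 f -> bm01 g ->
  \int[mu]_(x in I01) (f x - g x) =
  \int[mu]_(x in I01) f x - \int[mu]_(x in I01) g x.
Proof. exact: (Rintegral_bmB _ _ _ mu _ mI01 fin_I01). Qed.

Lemma Rintegral01Z c (f : R -> R) : bm01 f ->
  \int[mu]_(x in I01) (c * f x) = c * \int[mu]_(x in I01) f x.
Proof. exact: (Rintegral_bmZ _ _ _ mu _ mI01 fin_I01). Qed.

Lemma bm01_id : bm01 id.
Proof.
split; first exact: measurable_id.
by exists 1 => x /=; rewrite in_itv/= => /andP[x0 x1]; rewrite ger0_norm// ltW.
Qed.

Lemma bm01_indic_itv (i : interval R) : bm01 \1_[set` i].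
Proof. by apply: bounded_measurable_indic; exact: measurable_itv. Qed.

Lemma Rintegral_mul_indic (f : R -> R) (a b : R) : 0 <= a -> b <= 1 ->
  \int[mu]_(x in I01) (f x * \1_`[a, b[ x) = \int[mu]_(x in `[a, b[) f x.
Proof.
move=> a0 b1.
have -> : `[a, b[%classic = I01 `&` `[a, b[%classic.
  apply/esym/setIidr => x /=; rewrite !in_itv/= => /andP[ax xb].
  by rewrite (le_trans a0 ax) (lt_le_trans xb b1).
rewrite Rintegral_mkcondr; apply: eq_Rintegral => x xI.
by rewrite indicE patchE in_setI xI/=; case: (x \in _); rewrite ?mulr1 ?mulr0.
Qed.

Lemma Rintegral_indic_itv (a b : R) : 0 <= a -> a <= b -> b <= 1 ->
  \int[mu]_(x in I01) \1_`[a, b[ x = b - a.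
Proof.
move=> a0 ab b1.
transitivity (\int[mu]_(x in I01) (1 * \1_`[a, b[ x)).
  by apply: eq_Rintegral => x _; rewrite mul1r.
rewrite (Rintegral_mul_indic (fun=> 1))// Rintegral_cst; last first.
  exact: measurable_itv.
rewrite mul1r [X in fine X](_ : _ = lebesgue_measure `[a, b[%classic)//.
rewrite lebesgue_measure_itv/=.
rewrite lte_fin; case: ltP => // ba.
by apply/esym/eqP; rewrite subr_eq0 eq_le ab ba.
Qed.

Lemma Rintegral_id_itv (a b : R) : a < b ->
  \int[mu]_(x in `[a, b[) x = (b ^+ 2 - a ^+ 2) / 2.
Proof.
move=> ab.
(* Adding the null end point gives a closed interval, where the fundamental theorem of calculus is
   applied to [x ^+ 2 / 2]. *)
rewrite Rintegral_itv_bndo_bndc; last first.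
  apply: measurable_bounded_integrable => //.
  - exact: lebesgue_measure_itv_lty.
  - exists (`|a| + `|b|); split; first exact: num_real.
    move=> r Mr x /=; rewrite in_itv/= => /andP[ax xb].
    apply: le_trans (ltW Mr).
    by rewrite ler_norml; apply/andP; split; have := ler_norm (- a);
      have := ler_norm b; have := normr_ge0 a; have := normr_ge0 b;
      rewrite normrN; lra.
rewrite /Rintegral (@continuous_FTC2 _ _ (fun x => x ^+ 2 / 2))//=.
- by rewrite -mulrBl.
- by apply: continuous_subspaceT => x; exact: cvg_id.
- have dx x : derivable (fun x : R => x ^+ 2 / 2) x 1.
    by apply: derivableM => //; exact: exprn_derivable.
  have cx : continuous (fun x : R => x ^+ 2 / 2).
    by move=> x; apply: differentiable_continuous; exact/derivable1_diffP.
  split; [by move=> x _|exact/cvg_at_right_filter/cx|exact/cvg_at_left_filter/cx].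
- move=> x _; rewrite derive1E deriveMr; last exact: exprn_derivable.
  by rewrite exp_derive expr1 scaler1 -mulr_natl mulrA mulVf ?mul1r.
Qed.

End UnitInterval.

(** * Haar functions on the unit interval *)
Section Haar.
Variable R : realType.
Notation mu := (@lebesgue_measure R).
Notation I01 := (`[0, 1[%classic : set R).
Implicit Types (l w u x z : R) (m j p q : nat).

Definition cell l m : interval R := `[m%:R * l, m.+1%:R * l[.

(** Not normalised: the squared norm is [l], and Bessel's inequality divides by it. The length [l]
    need not be dyadic. *)
Definition haar l m x : R :=
  \1_`[m%:R * l, m%:R * l + l / 2[ x - \1_`[m%:R * l + l / 2, m.+1%:R * l[ x.

Lemma haarE l m x : haar l m x =
  (m%:R * l <= x < m%:R * l + l / 2)%R%:R -
  (m%:R * l + l / 2 <= x < m.+1%:R * l)%R%:R.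
Proof. by rewrite /haar !indicE !mem_setE !in_itv. Qed.

Lemma haar_out l m x : 0 < l -> x \notin cell l m -> haar l m x = 0.
Proof.
move=> l0; rewrite in_itv/= haarE.
have -> : m.+1%:R * l = m%:R * l + l by rewrite -natr1 mulrDl mul1r.
rewrite negb_and -leNgt -ltNge => /orP[h|h].
  by rewrite !(leNgt _ x) h (lt_trans h) ?subrr// ltrDl divr_gt0.
rewrite !(ltNge x) h (le_trans _ h) ?andbF ?subrr//.
by lra.
Qed.

Lemma haar_sqr l m x : 0 < l -> haar l m x ^+ 2 = \1_[set` cell l m] x.
Proof.
move=> l0; rewrite indicE mem_setE.
case: (boolP (x \in cell l m)) => [|/(haar_out _ _ _ l0) ->]; last first.
  by rewrite expr0n.
rewrite in_itv/= haarE => /andP[-> ->]/=; rewrite andbT.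
by case: ltP; rewrite /= ?subr0 ?sub0r ?sqrrN expr1n.
Qed.

Lemma bm01_haar l m : bm01 R (haar l m).
Proof. by apply: bounded_measurableB; exact: bm01_indic_itv. Qed.

Section Moments.
Variables (l : R) (m : nat).
Hypotheses (l0 : 0 < l) (ml1 : m.+1%:R * l <= 1).

Let a0 : 0 <= m%:R * l. Proof. by rewrite mulr_ge0// ltW. Qed.
Let mSl : m.+1%:R * l = m%:R * l + l. Proof. by rewrite -natr1 mulrDl mul1r. Qed.
Let lt1 : m%:R * l < m%:R * l + l / 2. Proof. by rewrite ltrDl divr_gt0. Qed.
Let lt2 : m%:R * l + l / 2 < m.+1%:R * l.
Proof. by rewrite mSl ltrD2l ltr_pdivrMr// mulr_natr mulr2n ltrDl. Qed.
Let b0 : 0 <= m%:R * l + l / 2. Proof. exact: le_trans a0 (ltW lt1). Qed.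
Let b1 : m%:R * l + l / 2 <= 1. Proof. exact: le_trans (ltW lt2) ml1. Qed.

Lemma Rintegral_haar : \int[mu]_(x in I01) haar l m x = 0.
Proof.
rewrite (Rintegral01B _ _ _ (bm01_indic_itv _ _) (bm01_indic_itv _ _)).
by rewrite !Rintegral_indic_itv ?(ltW lt1) ?(ltW lt2)// mSl; field.
Qed.

Lemma Rintegral_id_haar : \int[mu]_(x in I01) (x * haar l m x) = - (l ^+ 2 / 4).
Proof.
under eq_Rintegral do rewrite mulrBr.
rewrite (Rintegral01B _ (fun x => x * _) (fun x => x * _)
  (bounded_measurableM _ _ _ _ _ _ (bm01_id R) (bm01_indic_itv _ _))
  (bounded_measurableM _ _ _ _ _ _ (bm01_id R) (bm01_indic_itv _ _))).
rewrite !(Rintegral_mul_indic _ id)// !Rintegral_id_itv//.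
by rewrite mSl; field.
Qed.

Lemma Rintegral_haar_sqr : \int[mu]_(x in I01) (haar l m x ^+ 2) = l.
Proof.
under eq_Rintegral do rewrite haar_sqr//.
by rewrite Rintegral_indic_itv// ?(ltW (lt_trans lt1 lt2))// mSl; ring.
Qed.

(** A jump outside the cell leaves the step function constant on it, with value 1 exactly if [z]
    lies to the left, and the Haar function has mean zero. *)
Lemma Rintegral_step_haar z : z \notin cell l m ->
  \int[mu]_(x in I01) (\1_`]z, 1[ x * haar l m x) = 0.
Proof.
rewrite in_itv/= negb_and -leNgt -ltNge => zm.
have stepE x : x \in I01 ->
    \1_`]z, 1[ x * haar l m x = (z < m%:R * l)%R%:R * haar l m x.
  rewrite mem_setE in_itv/= => /andP[_ x1].
  rewrite indicE mem_setE in_itv/= x1 andbT.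
  case: (boolP (x \in cell l m)) => [|/(haar_out _ _ _ l0) ->]; last first.
    by rewrite !mulr0.
  rewrite in_itv/= => /andP[xm xM].
  by case/orP: zm => zm; [rewrite zm (lt_le_trans zm xm)|
    rewrite (ltNge z x) (ltNge z _) (le_trans (ltW xM) zm)/= (le_trans _ zm)//
      mSl lerDl ltW].
transitivity (\int[mu]_(x in I01) ((z < m%:R * l)%R%:R * haar l m x)).
  by apply: eq_Rintegral => x; exact: stepE.
rewrite (Rintegral01Z _ _ _ (bm01_haar _ _)).
by rewrite Rintegral_haar mulr0.
Qed.

End Moments.

(** Comparisons of [x] with grid points depend only on the index of its cell, so they reduce to
    comparisons of natural numbers. *)
Lemma le_cell u x m q : 0 < u -> x \in cell u m -> (q%:R * u <= x) = (q <= m)%N.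
Proof.
move=> u0; rewrite in_itv/= => /andP[mx xm]; case: leqP => qm.
  by apply: le_trans mx; rewrite ler_pM2r// ler_nat.
apply/negbTE; rewrite -ltNge; apply: lt_le_trans xm _.
by rewrite ler_pM2r// ler_nat.
Qed.

Lemma cell_inj u x m q : 0 < u -> x \in cell u m -> x \in cell u q -> m = q.
Proof.
move=> u0 xm xq; apply/eqP; rewrite eqn_leq.
rewrite -(le_cell _ _ _ _ u0 xq) -(le_cell _ _ _ _ u0 xm).
by move: xm xq; rewrite !in_itv/= => /andP[-> _] /andP[-> _].
Qed.

Lemma mem_cell_left u m : 0 < u -> m%:R * u \in cell u m.
Proof. by move=> u0; rewrite in_itv/= lexx ltr_pM2r// ltr_nat ltnS leqnn. Qed.

(** The length is an even multiple of [u], so both ends and also the midpoint of the Haar function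
    are grid points of step [u]; by [le_cell] none of them separates [x] from the left end of its
    cell. *)
Lemma haar_constant_on_cell u p m q x : 0 < u -> x \in cell u q ->
  haar (p.*2%:R * u) m x = haar (p.*2%:R * u) m (q%:R * u).
Proof.
move=> u0 xq.
have E1 : m%:R * (p.*2%:R * u) = (m * p.*2)%:R * u by rewrite natrM mulrA.
have E2 : m.+1%:R * (p.*2%:R * u) = (m.+1 * p.*2)%:R * u by rewrite natrM mulrA.
have E3 : (m * p.*2)%:R * u + p.*2%:R * u / 2 = (m * p.*2 + p)%:R * u.
  by rewrite natrD -muln2 !natrM; field.
rewrite !haarE E1 E2 E3 !(ltNge x) !(ltNge (q%:R * u)).
by rewrite !(le_cell _ _ _ _ u0 xq) !(le_cell _ _ _ _ u0 (mem_cell_left _ _ u0)).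
Qed.

(** The coarser function is constant on the cell of the finer one (zero there if the lengths agree,
    as the cells are then disjoint), and the finer one has mean zero. *)
Lemma haar_orthogonal_le w j m j' m' : 0 < w -> (j <= j')%N ->
    m'.+1%:R * (w / 2 ^+ j') <= 1 -> (j, m) != (j', m') ->
  \int[mu]_(x in I01) (haar (w / 2 ^+ j) m x * haar (w / 2 ^+ j') m' x) = 0.
Proof.
move=> w0 jj' m'1 ne.
have l0 i : 0 < w / 2 ^+ i by rewrite divr_gt0// exprn_gt0.
have [c hc] : exists c, forall x, x \in cell (w / 2 ^+ j') m' ->
    haar (w / 2 ^+ j) m x = c.
  move: jj'; rewrite leq_eqVlt => /predU1P[jj'|jj'].
    subst j'; exists 0 => x xm'; apply: haar_out => //; apply/negP => xm.
    by move: ne; rewrite (cell_inj _ _ _ _ (l0 j) xm xm') eqxx.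
  have -> : w / 2 ^+ j = (2 ^ (j' - j).-1).*2%:R * (w / 2 ^+ j').
    rewrite -mul2n -expnS prednK ?subn_gt0// natrX expfB//.
    by field; rewrite !expf_neq0.
  by eexists => x; exact: haar_constant_on_cell.
rewrite (_ : Rintegral _ _ _ =
    \int[mu]_(x in I01) (c * haar (w / 2 ^+ j') m' x)); last first.
  apply: eq_Rintegral => x _.
  by case: (boolP (x \in cell (w / 2 ^+ j') m')) => [/hc ->//|/haar_out ->//];
    rewrite !mulr0.
rewrite (Rintegral01Z _ _ _ (bm01_haar _ _)).
by rewrite Rintegral_haar ?mulr0.
Qed.

Lemma haar_orthogonal w j m j' m' : 0 < w ->
    m.+1%:R * (w / 2 ^+ j) <= 1 -> m'.+1%:R * (w / 2 ^+ j') <= 1 ->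
    (j, m) != (j', m') ->
  \int[mu]_(x in I01) (haar (w / 2 ^+ j) m x * haar (w / 2 ^+ j') m' x) = 0.
Proof.
move=> w0 m1 m'1 ne; case/orP: (leq_total j j') => jj.
  exact: haar_orthogonal_le.
under eq_Rintegral do rewrite mulrC.
by apply: haar_orthogonal_le => //; rewrite eq_sym.
Qed.

End Haar.

(** * The Haar system of the second coordinate, constant function included *)

Section HaarSystem.
Variable R : realType.
Notation mu := (@lebesgue_measure R).
Notation I01 := (`[0, 1[%classic : set R).

(* In the second coordinate the index [o = 0] stands for the constant function
   and [o = k.+1] for the Haar functions on dyadic intervals of length 2^-k. *)
Definition yside (o : nat) : R := 1 / 2 ^+ o.-1.

Definition yhaar (o m : nat) : R -> R :=
  if o is k.+1 then haar _ (1 / 2 ^+ k) m else fun=> 1.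

(** The integral of [y * yhaar o m y], which does not depend on the position [m]. *)
Definition ymoment (o : nat) : R :=
  if o is k.+1 then - ((1 / 2 ^+ k) ^+ 2 / 4) else 1 / 2.

Lemma yside_gt0 o : 0 < yside o.
Proof. by rewrite divr_gt0// exprn_gt0. Qed.

Lemma yside_le1 k m : (m < 2 ^ k)%N -> m.+1%:R * (1 / 2 ^+ k) <= 1 :> R.
Proof.
by move=> mk; rewrite mul1r ler_pdivrMr ?exprn_gt0// mul1r -natrX ler_nat.
Qed.

Lemma bm01_yhaar o m : bm01 R (yhaar o m).
Proof. by case: o => [|k]; [exact: bounded_measurable_cst|exact: bm01_haar]. Qed.

Lemma Rintegral_yhaar_sqr o m : (m < 2 ^ o.-1)%N ->
  \int[mu]_(y in I01) (yhaar o m y ^+ 2) = yside o.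
Proof.
case: o => [_|k mk]; last first.
  by rewrite Rintegral_haar_sqr ?yside_le1 ?(yside_gt0 k.+1).
rewrite /yhaar/= Rintegral_cst; last exact: measurable_itv.
rewrite [X in fine X](_ : _ = lebesgue_measure I01)// lebesgue_measure_itv/=.
by rewrite lte_fin ltr01/= /yside expr1n expr0 divr1 subr0 mulr1.
Qed.

Lemma Rintegral_id_yhaar o m : (m < 2 ^ o.-1)%N ->
  \int[mu]_(y in I01) (y * yhaar o m y) = ymoment o.
Proof.
case: o => [_|k mk]; last first.
  by rewrite Rintegral_id_haar ?yside_le1 ?(yside_gt0 k.+1).
under eq_Rintegral do rewrite mulr1.
by rewrite Rintegral_id_itv// expr1n expr0n subr0.
Qed.

(** For [o = 0] the only cell is [0, 1) itself, so the two hypotheses on [z] exclude each other;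
    otherwise this is the Haar case. *)
Lemma Rintegral_step_yhaar o m (z : R) : (m < 2 ^ o.-1)%N -> z \in `[0, 1[ ->
  z \notin cell _ (yside o) m ->
  \int[mu]_(y in I01) (\1_`]z, 1[ y * yhaar o m y) = 0.
Proof.
case: o => [|k mk _]; last first.
  by move=> zm; rewrite Rintegral_step_haar ?yside_le1 ?(yside_gt0 k.+1).
case: m => // _ z01; rewrite /cell /yside/= expr0 divr1 mul0r mulr1.
by rewrite z01.
Qed.

Lemma yhaar_orthogonal o m o' m' : (m < 2 ^ o.-1)%N -> (m' < 2 ^ o'.-1)%N ->
  (o, m) != (o', m') ->
  \int[mu]_(y in I01) (yhaar o m y * yhaar o' m' y) = 0.
Proof.
case: o o' => [|k] [|k'] /=.
- by rewrite expn0; case: m => //; case: m'.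
- move=> _ mk' _; under eq_Rintegral do rewrite mul1r.
  by rewrite Rintegral_haar ?yside_le1 ?(yside_gt0 k'.+1).
- move=> mk _ _; under eq_Rintegral do rewrite mulr1.
  by rewrite Rintegral_haar ?yside_le1 ?(yside_gt0 k.+1).
- by move=> mk mk' ne; apply: haar_orthogonal; rewrite ?yside_le1.
Qed.

End HaarSystem.

(** * Tensor products of Haar functions on the square *)
Section PlanarBound.
Variable R : realType.
Notation mu := (@lebesgue_measure R).
Notation mu2 := (@lebesgue_measure R \x @lebesgue_measure R)%E.
Notation I01 := (`[0, 1[%classic : set R).
Notation Q := (unit_square (R := R)).

Lemma measurable_unit_square : measurable Q.
Proof. by apply: measurableX; exact: measurable_itv. Qed.

Lemma fin_unit_square : (mu2 Q < +oo)%E.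
Proof. by apply: product_measure_lty; do ?[exact: mI01|exact: fin_I01]. Qed.

Definition bm2 := bounded_measurable _ _ R Q.

Lemma bm2_tensor (f g : R -> R) : bm01 R f -> bm01 R g ->
  bm2 (fun z => f z.1 * g z.2).
Proof.
move=> bf bg; apply: bounded_measurableM.
  by apply: bounded_measurable_fst => //; exact: mI01.
by apply: bounded_measurable_snd => //; exact: mI01.
Qed.

Lemma Rintegral_square_tensor (f g : R -> R) : bm01 R f -> bm01 R g ->
  \int[mu2]_(z in Q) (f z.1 * g z.2) =
  \int[mu]_(x in I01) f x * \int[mu]_(y in I01) g y.
Proof.
by move=> bf bg; apply: Rintegral_tensor => //; do ?[exact: mI01|exact: fin_I01].
Qed.

Lemma indic_cornerE (z x : R * R) :
  \1_(corner z) x = \1_`]z.1, 1[ x.1 * \1_`]z.2, 1[ x.2 :> R.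
Proof. by rewrite !indicE in_setX -natrM mulnb. Qed.

Lemma bm2_indic_corner z : bm2 \1_(corner z).
Proof.
rewrite (_ : \1_(corner z) = fun x => \1_`]z.1, 1[ x.1 * \1_`]z.2, 1[ x.2).
  by apply: bm2_tensor; exact: bm01_indic_itv.
by apply/funext => x; exact: indic_cornerE.
Qed.

Lemma bm2_weighted_discrepancy (P : {fset R * R}) (a : P -> R) :
  bm2 (weighted_discrepancy a).
Proof.
apply: bounded_measurableB.
  apply: bounded_measurable_sum => z; apply: bounded_measurableZ.
  exact: bm2_indic_corner.
by apply: bounded_measurableZ; apply: (bm2_tensor id id); exact: bm01_id.
Qed.

(** Every point is annihilated in one of the two coordinates, so its term factors to zero whatever
    its weight, and only the area term survives. *)
Lemma Rintegral_discrepancy_tensor (P : {fset R * R}) (a : P -> R)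
    (f g : R -> R) :
    bm01 R f -> bm01 R g ->
    (forall z, z \in P -> \int[mu]_(x in I01) (\1_`]z.1, 1[ x * f x) = 0 \/
                          \int[mu]_(x in I01) (\1_`]z.2, 1[ x * g x) = 0) ->
  \int[mu2]_(x in Q) (weighted_discrepancy a x * (f x.1 * g x.2)) =
  - (#|` P|%:R *
     (\int[mu]_(x in I01) (x * f x) * \int[mu]_(x in I01) (x * g x))).
Proof.
move=> bf bg fg0.
have bcorner (z : P) : bm2 (fun x => \1_(corner (val z)) x * (f x.1 * g x.2)).
  by apply: bounded_measurableM; [exact: bm2_indic_corner|exact: bm2_tensor].
have barea : bm2 (fun x => (x.1 * f x.1) * (x.2 * g x.2)).
  by apply: (bm2_tensor (fun x => x * f x) (fun x => x * g x));
    apply: bounded_measurableM => //; exact: bm01_id.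
transitivity (\int[mu2]_(x in Q)
    ((\sum_(z : P) a z * (\1_(corner (val z)) x * (f x.1 * g x.2))) -
     #|` P|%:R * ((x.1 * f x.1) * (x.2 * g x.2)))).
  apply: eq_Rintegral => x _; rewrite /weighted_discrepancy mulrBl mulr_suml.
  rewrite -[_ * (x.1 * x.2) * _]mulrA [x.1 * x.2 * _]mulrACA; congr (_ - _).
  by apply: eq_bigr => z _; rewrite -mulrA.
rewrite (Rintegral_bmB _ _ _ mu2 _ measurable_unit_square fin_unit_square); first last.
- exact: bounded_measurableZ.
- by apply: bounded_measurable_sum => z; apply: bounded_measurableZ; exact: bcorner.
rewrite (Rintegral_bm_sum _ _ _ mu2 _ measurable_unit_square fin_unit_square); last first.
  by move=> z; apply: bounded_measurableZ; exact: bcorner.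
rewrite big1 ?sub0r.
  rewrite (Rintegral_bmZ _ _ _ mu2 _ measurable_unit_square fin_unit_square)//.
  by rewrite (Rintegral_square_tensor (fun x => x * f x) (fun x => x * g x))//;
    apply: bounded_measurableM => //; exact: bm01_id.
move=> z _.
rewrite (Rintegral_bmZ _ _ _ mu2 _ measurable_unit_square fin_unit_square); last first.
  exact: bcorner.
rewrite (_ : Rintegral _ _ _ = 0) ?mulr0//.
transitivity (\int[mu2]_(x in Q) ((\1_`](val z).1, 1[ x.1 * f x.1) *
                                  (\1_`](val z).2, 1[ x.2 * g x.2))).
  by apply: eq_Rintegral => x _; rewrite indic_cornerE; ring.
rewrite (Rintegral_square_tensor (fun x => \1_`](val z).1, 1[ x * f x)
  (fun x => \1_`](val z).2, 1[ x * g x)); try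
  by apply: bounded_measurableM => //; exact: bm01_indic_itv.
by have [->|->] := fg0 _ (valP z); rewrite ?mul0r ?mulr0.
Qed.

End PlanarBound.

(** * Bessel's inequality over the boxes without points *)

Section HaarLowerBound.
Variables (R : realType) (w : R).
Hypothesis w0 : 0 < w.
Notation mu := (@lebesgue_measure R).
Notation mu2 := (@lebesgue_measure R \x @lebesgue_measure R)%E.
Notation Q := (unit_square (R := R)).
(** A shape, fixing the two side lengths, paired with a position, fixing the two cells. *)
Notation index := ((nat * nat) * (nat * nat))%type.

Definition xside (j : nat) : R := w / 2 ^+ j.

Lemma xside_gt0 j : 0 < xside j.
Proof. by rewrite divr_gt0// exprn_gt0. Qed.

(** The number of whole cells of length [xside j] that fit into [0, 1). *)
Definition xcount (j : nat) : nat := Num.truncn (xside j)^-1.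

Lemma xside_le1 j m : (m < xcount j)%N -> m.+1%:R * xside j <= 1.
Proof.
move=> mj; rewrite -ler_pdivlMr ?xside_gt0// div1r.
apply: (le_trans (y := (xcount j)%:R)); first by rewrite ler_nat.
by rewrite /xcount truncn_le// invr_ge0 ltW// xside_gt0.
Qed.

Definition haar2 (i : index) (z : R * R) : R :=
  haar R (xside i.1.1) i.2.1 z.1 * yhaar R i.1.2 i.2.2 z.2.

Definition in_box (i : index) (z : R * R) : bool :=
  (z.1 \in cell R (xside i.1.1) i.2.1) &&
  (z.2 \in cell R (yside R i.1.2) i.2.2).

(** The position of the only box of shape [s] that can contain [z]. *)
Definition box_of (s : nat * nat) (z : R * R) : nat * nat :=
  (Num.truncn (z.1 / xside s.1), Num.truncn (z.2 / yside R s.2)).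

Lemma cell_truncn (l x : R) m :
  0 < l -> x \in cell R l m -> Num.truncn (x / l) = m.
Proof.
move=> l0; rewrite in_itv/= => /andP[mx xm].
by apply/truncn_def; rewrite ler_pdivlMr// mx ltr_pdivrMr.
Qed.

Definition boxes (s : nat * nat) : seq (nat * nat) :=
  [seq (m1, m2) | m1 <- iota 0 (xcount s.1), m2 <- iota 0 (2 ^ s.2.-1)].

Lemma mem_boxes s m :
  (m \in boxes s) = (m.1 < xcount s.1)%N && (m.2 < 2 ^ s.2.-1)%N.
Proof.
case: m => m1 m2; apply/allpairsP/andP => /= [[[k1 k2] [/=]]|[m1s m2s]].
  by rewrite !mem_iota => k1s k2s [-> ->].
by exists (m1, m2); rewrite !mem_iota.
Qed.

Lemma uniq_boxes s : uniq (boxes s).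
Proof.
by apply: allpairs_uniq; rewrite ?iota_uniq// => -[? ?] [? ?] _ _ [-> ->].
Qed.

(** The positions of occupied boxes all lie in the image of [P] under [box_of s], so there are at
    most as many as points. The difference is real and may be negative. *)
Lemma count_empty_boxes (P : {fset R * R}) s :
  ((xcount s.1 * 2 ^ s.2.-1)%:R - #|` P|%:R : R) <=
  (count (fun m => all (fun z => ~~ in_box (s, m) z) P) (boxes s))%:R.
Proof.
rewrite lerBlDr -natrD ler_nat.
have <- : size (boxes s) = (xcount s.1 * 2 ^ s.2.-1)%N.
  by rewrite size_allpairs !size_iota.
rewrite -(count_predC (fun m => all (fun z => ~~ in_box (s, m) z) P)) leq_add2l.
rewrite -size_filter -(size_map (box_of s) P).
apply: uniq_leq_size; first by rewrite filter_uniq ?uniq_boxes.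
move=> m; rewrite mem_filter/= -has_predC => /andP[/hasP[z zP /=]].
rewrite negbK => /andP[z1 z2] _; apply/mapP; exists z => //.
rewrite /box_of (cell_truncn _ _ _ _ z1) ?xside_gt0//.
by rewrite (cell_truncn _ _ _ _ z2) ?yside_gt0//; case: m {z1 z2}.
Qed.

Lemma bm2_haar2 i : bm2 R (haar2 i).
Proof. by apply: bm2_tensor; [exact: bm01_haar|exact: bm01_yhaar]. Qed.

Lemma Rintegral_haar2_sqr s m : m \in boxes s ->
  \int[mu2]_(z in Q) (haar2 (s, m) z ^+ 2) = xside s.1 * yside R s.2.
Proof.
rewrite mem_boxes => /andP[m1 m2].
transitivity (\int[mu2]_(z in Q) ((haar R (xside s.1) m.1 z.1 ^+ 2) *
   (yhaar R s.2 m.2 z.2 ^+ 2))).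
  by apply: eq_Rintegral => z _; rewrite exprMn.
rewrite (Rintegral_square_tensor _ (fun x => haar R (xside s.1) m.1 x ^+ 2)
  (fun x => yhaar R s.2 m.2 x ^+ 2)); last 2 first.
- exact/bounded_measurableM/bm01_haar/bm01_haar.
- exact/bounded_measurableM/bm01_yhaar/bm01_yhaar.
by rewrite Rintegral_haar_sqr ?xside_gt0 ?xside_le1// Rintegral_yhaar_sqr.
Qed.

Lemma haar2_orthogonal s m s' m' : m \in boxes s -> m' \in boxes s' ->
  (s, m) != (s', m') ->
  \int[mu2]_(z in Q) (haar2 (s, m) z * haar2 (s', m') z) = 0.
Proof.
rewrite !mem_boxes => /andP[m1 m2] /andP[m1' m2'] ne.
transitivity (\int[mu2]_(z in Q)
   ((haar R (xside s.1) m.1 z.1 * haar R (xside s'.1) m'.1 z.1) *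
    (yhaar R s.2 m.2 z.2 * yhaar R s'.2 m'.2 z.2))).
  by apply: eq_Rintegral => z _; rewrite /haar2 mulrACA.
rewrite (Rintegral_square_tensor _
  (fun x => haar R (xside s.1) m.1 x * haar R (xside s'.1) m'.1 x)
  (fun x => yhaar R s.2 m.2 x * yhaar R s'.2 m'.2 x)); last 2 first.
- exact/bounded_measurableM/bm01_haar/bm01_haar.
- exact/bounded_measurableM/bm01_yhaar/bm01_yhaar.
(* Distinct indices differ in the (scale, cell) pair of at least one coordinate, and that factor of
   the integral vanishes. *)
have [E1|ne1] := eqVneq (s.1, m.1) (s'.1, m'.1); last first.
  by rewrite haar_orthogonal ?mul0r// xside_le1.
rewrite yhaar_orthogonal ?mulr0//; apply: contra_neq ne => E2.
case: s s' m m' E1 E2 {m1 m2 m1' m2'} => [? ?] [? ?] [? ?] [? ?] /=.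
by move=> [-> ->] [-> ->].
Qed.

(** A point outside the box lies outside one of its two cells, and the factor of that coordinate
    annihilates it. The negative first moment of [haar] cancels the sign of the area term. *)
Lemma Rintegral_discrepancy_haar2 (P : {fset R * R}) (a : P -> R) s m :
    (forall z, z \in P -> Q z) -> m \in boxes s ->
    all (fun z => ~~ in_box (s, m) z) P ->
  \int[mu2]_(z in Q) (weighted_discrepancy a z * haar2 (s, m) z) =
  #|` P|%:R * (xside s.1 ^+ 2 / 4) * ymoment R s.2.
Proof.
move=> PQ; rewrite mem_boxes => /andP[m1 m2] /allP empty.
rewrite (Rintegral_discrepancy_tensor _ P a (haar R (xside s.1) m.1)
  (yhaar R s.2 m.2)); last first.
- move=> z zP; have := empty _ zP; rewrite negb_and => /orP[z1|z2].
    by left; rewrite Rintegral_step_haar ?xside_gt0 ?xside_le1.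
  right; rewrite Rintegral_step_yhaar//.
  by have [_] := PQ _ zP.
- exact: bm01_yhaar.
- exact: bm01_haar.
rewrite Rintegral_id_haar ?xside_gt0 ?xside_le1// Rintegral_id_yhaar//.
by rewrite mulNr mulrN opprK mulrA.
Qed.

(** The share of the second coordinate in a Bessel quotient: squared moment over squared norm. *)
Definition yweight (o : nat) : R := ymoment R o ^+ 2 / yside R o.

Lemma haar_lower_bound (P : {fset R * R}) (a : P -> R) (S : seq (nat * nat)) :
    (forall z, z \in P -> Q z) -> uniq S ->
  \sum_(s <- S) #|` P|%:R ^+ 2 * (xside s.1 ^+ 3 / 16) * yweight s.2 *
    ((xcount s.1 * 2 ^ s.2.-1)%:R - #|` P|%:R)
  <= \int[mu2]_(z in Q) (weighted_discrepancy a z ^+ 2).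
Proof.
move=> PQ uS.
pose empty (i : index) := all (fun z => ~~ in_box i z) P.
pose I := [seq i <- [seq (s, m) | s <- S, m <- boxes s] | empty i].
have II i : i \in I -> i.2 \in boxes i.1 /\ empty i.
  rewrite mem_filter => /andP[ei /allpairsPdep[s [m [_ ms Ei]]]].
  by subst i; split.
have uI : uniq I.
  rewrite filter_uniq//; apply: allpairs_uniq_dep => // [s _|].
    exact: uniq_boxes.
  by move=> [? ?] [? ?] _ _ [-> ->].
have := bessel_inequality _ _ _ mu2 _ (measurable_unit_square R) (fin_unit_square R)
  _ I haar2 _ uI (bm2_weighted_discrepancy _ P a) bm2_haar2.
move=> bessel; apply: le_trans (bessel _ _); first last.
- move=> [s m] /II[/= ms _]; rewrite Rintegral_haar2_sqr//.
  by rewrite mulr_gt0 ?xside_gt0 ?yside_gt0.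
- move=> [s m] [s' m'] /II[/= ms _] /II[/= ms' _] ne.
  exact: haar2_orthogonal.
rewrite big_filter [leRHS]big_mkcond big_allpairs_dep/=.
apply: ler_sum => s _; rewrite -big_mkcond/=.
(* All empty boxes of shape [s] have the same Bessel quotient [c]; the first coordinate gives (l^2 /
   4)^2 / l = l^3 / 16. Since [c] is nonnegative, a lower bound on their number suffices. *)
pose c := #|` P|%:R ^+ 2 * (xside s.1 ^+ 3 / 16) * yweight s.2.
rewrite big_seq_cond (eq_bigr (fun=> c)); last first.
  move=> m /andP[ms em]; rewrite Rintegral_discrepancy_haar2// Rintegral_haar2_sqr//.
  rewrite /c /yweight; have := xside_gt0 s.1; have := yside_gt0 R s.2.
  by move=> /lt0r_neq0 y0 /lt0r_neq0 x0; field; rewrite x0 y0.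
rewrite -big_seq_cond big_const_seq iter_addr addr0 -[leRHS]mulr_natr ler_wpM2l//.
  have x0 := ltW (xside_gt0 s.1); have y0 := ltW (yside_gt0 R s.2).
  apply: mulr_ge0; last by rewrite /yweight divr_ge0 ?sqr_ge0.
  by rewrite mulr_ge0 ?sqr_ge0 ?divr_ge0 ?exprn_ge0.
exact: count_empty_boxes.
Qed.

End HaarLowerBound.

(** * Summation over the shapes *)
Section LevelSums.
Variable R : realType.

Lemma yweight0 : yweight R 0 = 1 / 4.
Proof. by rewrite /yweight /ymoment /yside expr0; field. Qed.

Lemma yweightS k : yweight R k.+1 = (1 / 8) ^+ k / 16.
Proof.
have -> : (1 / 8) ^+ k = ((2 ^+ k)^-1) ^+ 3 :> R.
  by rewrite -exprVn -exprM mulnC exprM; congr (_ ^+ _); field.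
rewrite /yweight /ymoment /yside/=.
by have x0 : 2 ^+ k != 0 :> R := expf_neq0 _ _; field.
Qed.

Lemma xside_cube (w : R) j : xside R w j ^+ 3 = w ^+ 3 * (1 / 8) ^+ j.
Proof.
rewrite /xside exprMn -exprVn -exprM mulnC exprM.
by congr (_ * _ ^+ _); field.
Qed.

Lemma xcount_ge (w : R) j : 2 ^+ j / w - 1 <= (xcount R w j)%:R.
Proof.
rewrite lerBlDr natr1 -invf_div ltW// /xcount /xside.
exact: truncnS_gt.
Qed.

Lemma xcount0_ge1 (w : R) : 0 < w -> w <= 1 -> (0 < xcount R w 0)%N.
Proof.
by move=> w0 w1; rewrite /xcount truncn_gt0 /xside expr0 divr1 invf_ge1.
Qed.

(* The rounding losses 2^(n-j), 1 <= j <= n, of [xcount_ge] are absorbed by the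
   single interval of index j = 0, which contributes 2^n. *)
Lemma sum_xcount_ge (w : R) n : 0 < w -> w <= 1 ->
  n%:R * (2 ^+ n / w) + 1 <=
  \sum_(0 <= j < n.+1) (xcount R w j)%:R * 2 ^+ (n - j).
Proof.
move=> w0 w1; elim: n => [|n ih].
  by rewrite big_nat1 subn0 mul0r add0r mulr1 ler1n xcount0_ge1.
rewrite big_nat_recr//= subnn mulr1.
(* The next level doubles the old terms, so the surplus 1 becomes 2 and pays for the unit lost by
   [xcount_ge] at the new index. *)
have -> : \sum_(0 <= j < n.+1) (xcount R w j)%:R * 2 ^+ (n.+1 - j) =
    2 * \sum_(0 <= j < n.+1) (xcount R w j)%:R * 2 ^+ (n - j) :> R.
  rewrite mulr_sumr; apply: eq_big_nat => j /andP[_ jn].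
  by rewrite subSn// exprS mulrCA.
have := xcount_ge w n.+1; rewrite exprS -[n.+1%:R]natr1 -!mulrA.
set a := 2 ^+ n / w in ih *; set s := \sum_(0 <= j < n.+1) _ in ih *.
set b := n%:R * a in ih *.
have -> : (n%:R + 1) * (2 * a) = 2 * b + 2 * a by rewrite /b; ring.
move: ih; set c := (xcount _ _ _)%:R; clearbody a b c s => ? ?; lra.
Qed.

(* Level [n] consists of the boxes of area w / 2^n, together with the pair of
   intervals of length w / 2^n and the constant function in the second
   coordinate. *)
Definition level_shape (n i : nat) : nat * nat :=
  if i is j.+1 then (j, (n - j).+1) else (n, 0).

Definition level_shapes (M L : nat) : seq (nat * nat) :=
  [seq level_shape n i | n <- iota M L, i <- iota 0 n.+2].

(** A zero second component singles out [i = 0]; otherwise [j] and [n - j] determine [n], the bounds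
    preventing truncated subtraction. *)
Lemma shape_inj n i n' i' : (i <= n.+1)%N -> (i' <= n'.+1)%N ->
  level_shape n i = level_shape n' i' -> n = n' /\ i = i'.
Proof.
case: i i' => [|i] [|i']; rewrite /level_shape => hi hi' [] //.
by move=> Ei E; split; lia.
Qed.

Lemma uniq_shapes M L : uniq (level_shapes M L).
Proof.
apply: allpairs_uniq_dep => [|n _|]; rewrite ?iota_uniq//.
have dep p : p \in [seq @Tagged nat n (fun=> nat) i |
                      n <- iota M L, i <- iota 0 n.+2] ->
    (tagged p <= (tag p).+1)%N.
  case/allpairsPdep => n [i [_ hi E]]; subst p.
  by move: hi; rewrite mem_iota => /andP[].
move=> [n i] [n' i'] /dep/= hi /dep/= hi' /(shape_inj _ _ _ _ hi hi')[En Ei].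
by subst n' i'.
Qed.


(** The summand of [haar_lower_bound], with [N] for the number of points. *)
Definition shape_weight (w : R) (N : nat) (s : nat * nat) : R :=
  N%:R ^+ 2 * (xside R w s.1 ^+ 3 / 16) * yweight R s.2 *
    ((xcount R w s.1 * 2 ^ s.2.-1)%:R - N%:R).

(** All shapes of a level share the factor [c], since 8^-j 8^-(n-j) = 8^-n. The shape with the
    constant function counts four times, its [yweight] being 1/4 instead of 1/16, and the final
    [- 4] covers its rounding loss. *)
Lemma level_bound (w : R) N n : 0 < w -> w <= 1 ->
  N%:R ^+ 2 * w ^+ 3 * (1 / 8) ^+ n / 256 *
    ((n%:R + 4) * (2 ^+ n / w) - (n%:R + 5) * N%:R - 4) <=
  \sum_(i <- iota 0 n.+2) shape_weight w N (level_shape n i).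
Proof.
move=> w0 w1; rewrite -[iota _ _]/(index_iota 0 n.+2) big_nat_recl//.
pose c := N%:R ^+ 2 * w ^+ 3 * (1 / 8) ^+ n / 256.
have -> : shape_weight w N (level_shape n 0) = c * (4 * ((xcount R w n)%:R - N%:R)).
  rewrite /shape_weight xside_cube yweight0 expn0 muln1 /c/=; field => //.
rewrite [X in _ <= _ + X](_ : _ =
    c * (\sum_(0 <= j < n.+1) (xcount R w j)%:R * 2 ^+ (n - j) -
         n.+1%:R * N%:R)); last first.
  rewrite mulrBr mulr_sumr.
  have -> : c * (n.+1%:R * N%:R) = \sum_(0 <= j < n.+1) c * N%:R.
    by rewrite sumr_const_nat subn0 -[RHS]mulr_natl mulrCA.
  rewrite -sumrB; apply: eq_big_nat => j /andP[_]; rewrite ltnS => jn.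
  rewrite /shape_weight xside_cube yweightS natrM natrX /=.
  rewrite /c; have -> : (1 / 8 : R) ^+ n = (1 / 8) ^+ (n - j) * (1 / 8) ^+ j.
    by rewrite -exprD subnK.
  by field.
rewrite -/c -mulrDr ler_wpM2l//.
  by rewrite /c divr_ge0 ?mulr_ge0 ?exprn_ge0 ?divr_ge0// ltW.
have := sum_xcount_ge w n w0 w1; have := xcount_ge w n.
rewrite -[n.+1%:R]natr1; set s := \sum_(0 <= j < n.+1) _; set a := 2 ^+ n / w.
set k := (xcount R w n)%:R; set x := n%:R; set y := N%:R.
by clear c; clearbody s a k x y => ? ?; lra.
Qed.

End LevelSums.

(** * Choice of the scale, and the bound in terms of log2 of the number of points *)

Section LogBound.
Variable R : realType.
Notation mu2 := (@lebesgue_measure R \x @lebesgue_measure R)%E.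
Notation Q := (unit_square (R := R)).

(** The sums of x^k and k x^k for x = 1/4 and x = 1/8: the full series are 4/3, 4/9 and 8/7, 8/49,
    and the powers with exponent [L] are the tails. *)
Lemma sum_level_terms (A B C p q : R) L :
  \sum_(0 <= k < L) (p * (1 / 4) ^+ k * (A + k%:R) -
    q * (1 / 8) ^+ k * (B + k%:R) - C * (1 / 8) ^+ k) =
  p * (4 / 3 * A + 4 / 9 - (1 / 4) ^+ L * (4 / 3 * (A + L%:R) + 4 / 9)) -
  q * (8 / 7 * B + 8 / 49 - (1 / 8) ^+ L * (8 / 7 * (B + L%:R) + 8 / 49)) -
  C * (8 / 7) * (1 - (1 / 8) ^+ L).
Proof.
elim: L => [|L ih]; first by rewrite big_geq// !expr0; field.
by rewrite big_nat_recr//= ih !exprS -[L.+1%:R]natr1; field.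
Qed.

(** For this [w] the box area at level [M + k] is t 2^-k / N, so all powers of 2^M cancel and [M]
    enters only linearly. *)
Lemma level_term (t : R) N M k : (0 < N)%N -> 0 < t ->
  let w := t * 2 ^+ M / N%:R in
  N%:R ^+ 2 * w ^+ 3 * (1 / 8) ^+ (M + k) / 256 *
    (((M + k)%:R + 4) * (2 ^+ (M + k) / w) - ((M + k)%:R + 5) * N%:R - 4) =
  (t ^+ 2 * (1 / 4) ^+ k * (M%:R + 4 + k%:R) -
   t ^+ 3 * (1 / 8) ^+ k * (M%:R + 5 + k%:R) -
   4 * t ^+ 3 / N%:R * (1 / 8) ^+ k) / 256 :> R.
Proof.
move=> N0 t0 w; rewrite /w natrD !exprD.
have p2 i j : (1 / 2 ^+ j) ^+ i = ((2 ^+ i)^-1) ^+ j :> R.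
  by rewrite div1r !exprVn -!exprM mulnC.
have e4 j : (1 / 4) ^+ j = (1 / 2 ^+ j) ^+ 2 :> R.
  by rewrite p2; congr (_ ^+ _); field.
have e8 j : (1 / 8) ^+ j = (1 / 2 ^+ j) ^+ 3 :> R.
  by rewrite p2; congr (_ ^+ _); field.
rewrite !e4 !e8.
have N0' : N%:R != 0 :> R by rewrite pnatr_eq0 -lt0n.
have t0' := lt0r_neq0 t0.
have x0 : 2 ^+ M != 0 :> R := expf_neq0 _ (lt0r_neq0 (ltr0n _ 2)).
have y0 : 2 ^+ k != 0 :> R := expf_neq0 _ (lt0r_neq0 (ltr0n _ 2)).
by field; rewrite t0' N0' x0 y0.
Qed.

Lemma ler_exp4 L : (7 <= L)%N -> 53 * L%:R <= 4 ^+ L :> R.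
Proof.
move=> L7; rewrite -natrX -natrM ler_nat.
elim: L L7 => // L ih; rewrite leq_eqVlt => /predU1P[<-//|].
by rewrite ltnS => /[dup] L7 /ih; rewrite expnS; lia.
Qed.

(** The slope in [M] is exact: t^2 (4/3 - 8 t / 7) / 256 = 49 / 216^2 at t = 7/9. The constant terms
    must pay for the [+ 1], the rounding term in 1/N and the truncated tail. *)
Lemma sum_level_terms_ge (N M : nat) (t := 7 / 9 : R) : (5 <= N)%N ->
  49 / 216 ^+ 2 * (M%:R + 1) <=
  \sum_(0 <= k < M + 7) ((t ^+ 2 * (1 / 4) ^+ k * (M%:R + 4 + k%:R) -
   t ^+ 3 * (1 / 8) ^+ k * (M%:R + 5 + k%:R) -
   4 * t ^+ 3 / N%:R * (1 / 8) ^+ k) / 256).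
Proof.
move=> N5; rewrite -mulr_suml sum_level_terms /t.
(* Before the division by 256 the tail costs at most (8/3) t^2 / 53, just below the slack 22.4 / 729
   that remains at N = 5. *)
have : (1 / 4) ^+ (M + 7) * (M + 7)%:R <= 1 / 53 :> R.
  rewrite expr_div_n expr1n mulrAC mul1r ler_pdivrMr ?exprn_gt0//.
  by have := ler_exp4 (M + 7) (leq_addl _ _); lra.
have X0 : 0 <= (1 / 4) ^+ (M + 7) :> R by rewrite exprn_ge0.
have Y0 : 0 <= (1 / 8) ^+ (M + 7) :> R by rewrite exprn_ge0.
have m0 : 0 <= M%:R :> R by [].
have : N%:R^-1 <= 5^-1 :> R.
  by rewrite lef_pV2 ?posrE ?ltr0n ?ler_nat// (leq_trans _ N5).
have : 0 <= N%:R^-1 :> R by rewrite invr_ge0.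
rewrite natrD; move: X0 Y0 m0.
move: ((1 / 4) ^+ (M + 7)) ((1 / 8) ^+ (M + 7)) (M%:R : R) (N%:R^-1 : R) => X Y m v.
move=> X0 Y0 m0 v0 v5 Xm.
have Ym : 0 <= Y * m by exact: mulr_ge0.
have vY : 0 <= v * Y by exact: mulr_ge0.
by lra.
Qed.

Lemma discrepancy_ge_large (P : {fset R * R}) (a : P -> R) :
    (forall z, z \in P -> Q z) -> (5 <= #|` P|)%N ->
  exists m : nat, (#|` P| <= 2 ^ m)%N /\
    49 / 216 ^+ 2 * m%:R <= \int[mu2]_(z in Q) (weighted_discrepancy a z ^+ 2).
Proof.
move=> PQ N5; set N := #|` P| in N5 *.
(* The largest [M] with 7 * 2^M <= 9 N, that is with [w <= 1]; maximality gives N < (7/9) 2^(M+1),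
   so [M.+1] can serve as the witness. *)
pose M := trunc_log 2 (9 * N %/ 7).
have N0 : (0 < N)%N by exact: leq_trans N5.
have /andP[M1 M2] : (2 ^ M <= 9 * N %/ 7 < 2 ^ M.+1)%N.
  by apply: trunc_log_bounds => //; rewrite divn_gt0//; lia.
have {}M1 : (7 * 2 ^ M <= 9 * N)%N by lia.
have {}M2 : (9 * N < 7 * 2 ^ M.+1)%N by lia.
exists M.+1; split; first by rewrite expnS in M2 *; lia.
pose t : R := 7 / 9; pose w : R := t * 2 ^+ M / N%:R.
have t0 : 0 < t by rewrite divr_gt0.
have w0 : 0 < w by rewrite divr_gt0 ?mulr_gt0 ?exprn_gt0 ?ltr0n.
have w1 : w <= 1.
  rewrite /w ler_pdivrMr ?ltr0n// mul1r /t.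
  by move: M1; rewrite -(ler_nat R) !natrM natrX; lra.
apply: le_trans (haar_lower_bound R w w0 P a (level_shapes M (M + 7)) PQ
  (uniq_shapes _ _)).
rewrite -/N big_allpairs_dep -[M.+1%:R]natr1.
apply: le_trans (sum_level_terms_ge N M N5) _.
have -> : iota M (M + 7) = [seq (M + k)%N | k <- iota 0 (M + 7)].
  by rewrite -iotaDl addn0.
rewrite /index_iota subn0 big_map; apply: ler_sum => k _.
rewrite -level_term//; exact: level_bound.
Qed.

(* The rounding term 4 t^3 / N is too large for the general argument when N < 5. *)
Lemma discrepancy_ge_small (P : {fset R * R}) (a : P -> R) :
    (forall z, z \in P -> Q z) -> (2 <= #|` P| <= 4)%N ->
  49 / 216 ^+ 2 * 2 <= \int[mu2]_(z in Q) (weighted_discrepancy a z ^+ 2).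
Proof.
move=> PQ N24.
(* Strips of width 1/4, 1/8 and 1/16 over the full second coordinate suffice. With [w = 1] there are
   exactly 2^j of them, without rounding loss. *)
apply: le_trans (haar_lower_bound R 1 ltr01 P a [:: (2, 0); (3, 0); (4, 0)]%N
  PQ isT).
have xcount1 j : xcount R 1 j = (2 ^ j)%N.
  by rewrite /xcount /xside invf_div divr1 -natrX natrK.
rewrite !big_cons big_nil !xcount1 /= !yweight0 !xside_cube.
by case: #|` P| N24 => [|[|[|[|[|n]]]]]//= _; lra.
Qed.

Lemma discrepancy_ge_log2 (P : {fset R * R}) (a : P -> R) :
    (forall z, z \in P -> Q z) ->
  exists m : nat, (#|` P| <= 2 ^ m)%N /\
    49 / 216 ^+ 2 * m%:R <= \int[mu2]_(z in Q) (weighted_discrepancy a z ^+ 2).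
Proof.
move=> PQ; case: (leqP 5 #|` P|) => [|N5]; first exact: discrepancy_ge_large.
case: (leqP #|` P| 1) => [N1|N2].
  exists 0; split => //; rewrite mulr0.
  by apply: Rintegral_ge0 => z _; exact: sqr_ge0.
by exists 2; split; [|apply: discrepancy_ge_small => //; rewrite N2].
Qed.

End LogBound.

(** * Numerical bounds for ln 2 *)
Section LnTwo.
Variable R : realType.

Lemma series_exp_coeff_le_expR (x : R) n :
  0 <= x -> series (exp_coeff x) n <= expR x.
Proof.
move=> x0; apply: nondecreasing_cvgn_le; last exact: is_cvg_series_exp_coeff.
by apply: nondecreasing_series => k _ _; exact: exp_coeff_ge0.
Qed.

(* The partial sums augmented by twice the next term decrease. *)
Lemma expR_le_series_exp_coeff (x : R) n : 0 <= x <= 1 -> (0 < n)%N ->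
  expR x <= series (exp_coeff x) n + 2 * exp_coeff x n.
Proof.
move=> /andP[x0 x1] n0.
have decr k : series (exp_coeff x) (n + k)%N + 2 * exp_coeff x (n + k)%N <=
    series (exp_coeff x) n + 2 * exp_coeff x n.
  elim: k => [|k ih]; first by rewrite addn0.
  rewrite addnS; apply: le_trans ih; rewrite seriesSr -addrA lerD2l.
  have e0 := exp_coeff_ge0 (n + k)%N x0.
  have -> : exp_coeff x (n + k).+1 = exp_coeff x (n + k)%N * (x / (n + k).+1%:R).
    rewrite /exp_coeff/= exprS factS natrM invfM; ring.
  (* Each coefficient is at most half the previous one, because [x <= 1] and the new index is at
     least 2. *)
  suff /(ler_wpM2l e0) : x / (n + k).+1%:R <= 1 / 2.
    have half (e y : R) : y <= e * (1 / 2) -> e + 2 * y <= 2 * e by move=> ?; lra.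
    exact: half.
  rewrite ler_pdivrMr ?ltr0n//; apply: (le_trans x1).
  by rewrite mul1r ler_pdivlMl// mulr1 ler_nat; lia.
apply: limr_le; first exact: is_cvg_series_exp_coeff.
exists n => // m /= nm; rewrite -(subnKC nm); apply: le_trans (decr (m - n)%N).
by rewrite lerDl mulr_ge0// exp_coeff_ge0.
Qed.

(** The precision is what the six decimals of the constant require. Both bounds are exponentiated
    and compared with 2 through partial sums of the exponential series. *)
Lemma ln2_bounds :
  (693 * 10 ^+ 3 + 122) / 10 ^+ 6 <= ln 2 :> R /\
  ln 2 <= (693 * 10 ^+ 3 + 156) / 10 ^+ 6 :> R.
Proof.
have x01 : is_true (0 <= ((693 * 10 ^+ 3 + 122) / 10 ^+ 6 : R) <= 1).
  by apply/andP; split; lra.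
split.
  rewrite -[leLHS]expRK ler_ln ?posrE ?expR_gt0//.
  apply: le_trans (expR_le_series_exp_coeff _ 7 x01 _) _ => //.
  rewrite /series/= /exp_coeff !big_nat_recr//= big_geq// !factS fact0; lra.
rewrite -[leRHS]expRK ler_ln ?posrE ?expR_gt0//.
apply: le_trans (series_exp_coeff_le_expR _ 8 _); last by lra.
rewrite /series/= /exp_coeff !big_nat_recr//= big_geq// !factS fact0; lra.
Qed.

End LnTwo.

(** * From log2 to the natural logarithm, and the decimals of the constant *)

Theorem theorem4 (R : realType) :
  let c : R := 7 / (216 * Num.sqrt (ln 2)) in
  (forall (N : nat) (P : {fset R * R}) (a : P -> R),
     (0 < N)%N ->
     #|` P| = N ->
     (forall z : R * R, z \in P -> unit_square z) ->
     c * Num.sqrt (ln N%:R) <= L2norm_square (weighted_discrepancy a))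
  /\ (38 * 10 ^+ 3 + 925) / 10 ^+ 6 <= c < (38 * 10 ^+ 3 + 926) / 10 ^+ 6.
Proof.
move=> c.
have [ln2l ln2u] := ln2_bounds R.
have ln20 : 0 < ln 2 :> R by lra.
have s0 : 0 < Num.sqrt (ln 2) :> R by rewrite sqrtr_gt0.
have sE : Num.sqrt (ln 2) ^+ 2 = ln 2 :> R by rewrite sqr_sqrtr// ltW.
have c0 : 0 < c by rewrite divr_gt0// mulr_gt0.
have cE : c ^+ 2 = 49 / 216 ^+ 2 / ln 2.
  by rewrite /c -[in RHS]sE; field; rewrite lt0r_neq0.
split; last first.
  (* Clearing the denominator leaves bounds on the positive [s], which follow from [s ^+ 2 = ln 2]
     and the bounds on [ln 2]. *)
  rewrite /c; move: s0 sE; set s := Num.sqrt _ => s0 sE.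
  rewrite ler_pdivlMr ?mulr_gt0// ltr_pdivrMr ?mulr_gt0//.
  by apply/andP; split; nra.
move=> N P a N0 PN PQ.
have [m [Nm mI]] := discrepancy_ge_log2 R P a PQ.
have lhs0 : 0 <= c * Num.sqrt (ln N%:R) by rewrite mulr_ge0 ?sqrtr_ge0// ltW.
rewrite /L2norm_square -(ger0_norm lhs0).
have lnN : 0 <= ln N%:R :> R by rewrite ln_ge0// ler1n.
rewrite -sqrtr_sqr ler_wsqrtr//.
(* Squared, the left side is (49 / 216^2) ln N / ln 2, and ln N <= m ln 2 because N <= 2^m. *)
apply: le_trans mI; rewrite exprMn cE sqr_sqrtr//.
rewrite -[_ / ln 2 * _]mulrA ler_wpM2l//.
rewrite mulrC ler_pdivrMr// mulr_natl -lnXn// -natrX.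
by rewrite ler_ln ?posrE ?ltr0n ?expn_gt0// ler_nat -PN.
Qed.
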